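(* Let $\mathcal{C}$ be a root class of groups consisting only of periodic groups and let $X$ be an abelian group. Then the following statements hold. 1. If $X$ has the property $\mathcal{C}\mbox{-}\mathfrak{Sep}$, then $X$ is weakly $\mathcal{C}$-bounded. 2. If $X$ is weakly $\mathcal{C}$-bounded, then $X$ has the properties $\mathcal{C}\mbox{-}\mathfrak{Sep}$ and $\mathcal{P}\mbox{-}\mathfrak{Sep}$, where $$\mathcal{P} = \bigcup_{p \in \mathfrak{P}(\mathcal{C})} \mathcal{F}_{p}$$ and $\mathcal{F}_{p}$ is the class of finite $p$-groups.
   Context: As usual, classes of groups are closed under isomorphism. A class of groups $\mathcal{C}$ is called a root class if it contains at least one non-trivial group and is closed under taking subgroups, extensions, and Cartesian (i.e. unrestricted direct) products of the form $\prod_{y \in Y} X_{y}$, where $X, Y \in \mathcal{C}$ and $X_{y}$ is an isomorphic copy of $X$ for each $y \in Y$. For a class of periodic groups $\mathcal{C}$ (not necessarily root), $\mathfrak{P}(\mathcal{C})$ denotes the set of all primes each of which divides the order of an element of some $\mathcal{C}$-group. For a set of primes $\mathfrak{P}$, $\mathfrak{P}'$ denotes the set of all primes not in $\mathfrak{P}$. A subgroup $Y$ of a group $X$ is $\mathfrak{P}'$-isolated in $X$ if, for any $x \in X$ and $q \in \mathfrak{P}'$, $x^{q} \in Y$ implies $x \in Y$. A subgroup $Y$ of a group $X$ is $\mathcal{C}$-separable in $X$ if for any $x \in X \setminus Y$ there exists a homomorphism $\sigma$ of $X$ onto a group from $\mathcal{C}$ such that $x\sigma \notin Y\sigma$. For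 a class $\mathcal{C}$ of periodic groups, a group $X$ has the property $\mathcal{C}\mbox{-}\mathfrak{Sep}$ if all $\mathfrak{P}(\mathcal{C})'$-isolated subgroups of $X$ are $\mathcal{C}$-separable in $X$. For an abelian group $A$ and $p \in \mathfrak{P}(\mathcal{C})$, the subgroup of all elements of $p$-power order of $A$ is called a primary $\mathfrak{P}(\mathcal{C})$-component of $A$. An abelian group $A$ is weakly $\mathcal{C}$-bounded if, for any quotient group $B$ of $A$, all the primary $\mathfrak{P}(\mathcal{C})$-components of $B$ are of finite exponent. *)

(* Defs.v *)
From HB Require Import structures.
From mathcomp Require Import all_boot all_fingroup all_solvable.
From mathcomp Require Import boolp.

Set Implicit Arguments.
Unset Strict Implicit.
Unset Printing Implicit Defensive.

Local Open Scope group_scope.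

(* Groups are arbitrary, possibly infinite, [groupType]s.  A morphism of groups
   is a [{multiplicative G -> H}]; such a map preserves 1 and inverses.
   Subsets are boolean predicates, as in the library's [group_closed] and
   [subGroupType]; the classical axioms of [boolp] turn any [Prop]-valued
   predicate into a boolean one, so that no subset is excluded. *)

Definition abelian_group (G : groupType) : Prop := forall x y : G, commute x y.

Definition surj (A B : Type) (f : A -> B) : Prop := forall y, exists x, f x = y.

Definition isomorphic (G H : groupType) : Prop :=
  exists f : {multiplicative G -> H}, bijective f.

(* Quotients are taken up to isomorphism. *)
Definition quotient_of (G Q : groupType) : Prop :=
  exists f : {multiplicative G -> Q}, surj f.

(* [E] is an extension of [N] by [Q]: 1 -> N -> E -> Q -> 1 is exact. *)
Definition extension_of (N Q E : groupType) : Prop :=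
  exists (i : {multiplicative N -> E}) (f : {multiplicative E -> Q}),
    [/\ injective i, surj f &
        forall e : E, f e = 1 <-> exists n : N, i n = e].

Definition has_order (G : groupType) (x : G) (n : nat) : Prop :=
  [/\ (0 < n)%N, x ^+ n = 1 &
      forall m : nat, (0 < m)%N -> x ^+ m = 1 -> (n <= m)%N].

Definition periodic (G : groupType) : Prop :=
  forall x : G, exists n, has_order x n.

Section CartesianProduct.
Variables (I : Type) (F : I -> groupType).

Definition cartesian_product : Type := forall i : I, F i.

HB.instance Definition _ := Choice.on cartesian_product.

Implicit Types f g h : cartesian_product.

Definition cart_one : cartesian_product := fun=> 1.
Definition cart_inv f : cartesian_product := fun i => (f i)^-1.
Definition cart_mul f g : cartesian_product := fun i => f i * g i.

Fact cart_mulgA : associative cart_mul.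
Proof. by move=> f g h; apply/functional_extensionality_dep => i; exact: mulgA. Qed.
Fact cart_mul1g : left_id cart_one cart_mul.
Proof. by move=> f; apply: functional_extensionality_dep => i; exact: mul1g. Qed.
Fact cart_mulg1 : right_id cart_one cart_mul.
Proof. by move=> f; apply: functional_extensionality_dep => i; exact: mulg1. Qed.
Fact cart_mulVg : left_inverse cart_one cart_inv cart_mul.
Proof. by move=> f; apply: functional_extensionality_dep => i; exact: mulVg. Qed.
Fact cart_mulgV : right_inverse cart_one cart_inv cart_mul.
Proof. by move=> f; apply: functional_extensionality_dep => i; exact: mulgV. Qed.

HB.instance Definition _ := isGroup.Build cartesian_product
  cart_mulgA cart_mul1g cart_mulg1 cart_mulVg cart_mulgV.

End CartesianProduct.

Record root_class (C : groupType -> Prop) : Prop := RootClass {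
  root_isom : forall G H : groupType, isomorphic G H -> C G -> C H;
  root_nontrivial : exists2 G : groupType, C G & exists x : G, x <> 1;
  root_sub : forall (G : groupType) (S : pred G) (H : subGroupType S),
    C G -> C H;
  root_ext : forall N Q E : groupType,
    extension_of N Q E -> C N -> C Q -> C E;
  root_prod : forall (X Y : groupType) (F : Y -> groupType),
    C X -> C Y -> (forall y : Y, isomorphic X (F y)) ->
    C (cartesian_product F)
}.

Definition periodic_class (C : groupType -> Prop) : Prop :=
  forall G : groupType, C G -> periodic G.

Definition class_primes (C : groupType -> Prop) (p : nat) : Prop :=
  prime p /\
  exists2 G : groupType, C G &
    exists (x : G) (n : nat), has_order x n /\ (p %| n)%N.

Definition prime_compl (P : nat -> Prop) (q : nat) : Prop :=
  prime q /\ ~ P q.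

Definition isolated (P : nat -> Prop) (X : groupType) (Y : {pred X}) : Prop :=
  forall (x : X) (q : nat), P q -> x ^+ q \in Y -> x \in Y.

Definition separable (C : groupType -> Prop) (X : groupType) (Y : {pred X})
    : Prop :=
  forall x : X, x \notin Y ->
    exists2 G : groupType, C G &
    exists2 s : {multiplicative X -> G}, surj s &
      ~ exists2 y : X, y \in Y & s y = s x.

Definition Sep (C : groupType -> Prop) (X : groupType) : Prop :=
  forall Y : {pred X}, group_closed Y ->
    isolated (prime_compl (class_primes C)) Y -> separable C Y.

Definition primary_component (p : nat) (A : groupType) (x : A) : Prop :=
  exists k : nat, has_order x (p ^ k)%N.

Definition finite_exponent (A : groupType) (S : A -> Prop) : Prop :=
  exists2 n : nat, (0 < n)%N & forall x : A, S x -> x ^+ n = 1.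

Definition weakly_bounded (C : groupType -> Prop) (A : groupType) : Prop :=
  forall B : groupType, quotient_of A B ->
    forall p : nat, class_primes C p ->
      finite_exponent (@primary_component p B).

Definition finite_pgroup (p : nat) (G : groupType) : Prop :=
  exists2 T : finGroupType, p.-group [set: T] & isomorphic T G.

Definition finite_primary_class (C : groupType -> Prop) (G : groupType) : Prop :=
  exists2 p : nat, class_primes C p & finite_pgroup p G.

(* Main.v *)
Require Import Defs.
From HB Require Import structures.
From mathcomp Require Import all_boot all_fingroup.
From mathcomp Require Import generic_quotient zmodp cyclic pgroup.
From mathcomp Require Import boolp classical_sets.

(** Write P for the set of primes of [C], so that [Y] is assumed to be
    P'-isolated.

    A group [G] in [C] has finite exponent: [C] contains the Cartesian power of
    [G] indexed by [G] itself, and the order of its diagonal element, the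
    identity map, is an exponent of [G] ([root_class_exponent]).

    From Sep to boundedness.  Let [B] be a quotient of [X], and p in P.
    Separability into groups of finite exponent means that subgroups are closed
    for a p-adic topology: if [K u] fails while [K (u ^+ p)] holds, then there
    is an [n] such that [u / t ^+ (p ^ n)] lies outside [K] for every [t] in the
    p-component of [B] ([Sep_padically_closed]).  If the p-component had
    infinite exponent, then the elements killed by p that are p^n-th powers in
    it would form a decreasing sequence of nontrivial subgroups, with trivial
    intersection as the trivial subgroup is closed.  Elements u_0, u_1, u_2, ...
    of these subgroups, each outside the term that contains the next ones, are
    independent; the subgroup generated by the quotients u_n / u_(n+1) omits
    u_0, but contains u_0 / u_n for all n, so u_0 lies in its closure
    ([exists_nonclosed_subgroup]).

    From boundedness to Sep.  Let [B] be X / Y and [b] the nontrivial image in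
    it of a point outside [Y].  Some p in P is such that [b] is not a power of
    [b ^+ p] ([prime_not_power]).  If [b] had p^n-th roots for all n, their
    images in B / <b^p> would be p-elements of unbounded order; so boundedness
    yields an [a] for which [b] is not a p^a-th power.  A subgroup maximal among
    those that contain all p^a-th powers and avoid [b] has a quotient of
    exponent dividing p^a in which every nontrivial subgroup contains the image
    of [b], and such a group is cyclic ([monolithic_cyclic]).  Cyclic p-groups
    are finite p-groups, and they are in [C] since they are iterated extensions
    of groups of order p ([root_class_cyclic]). *)

Set Implicit Arguments.
Unset Strict Implicit.
Unset Printing Implicit Defensive.

Local Open Scope group_scope.

(* Division of elements, rather than quotients of finite groups. *)
Local Notation "x / y" := (x * y^-1) : group_scope.

(** * Orders of elements and subgroups *)

Lemma inj_surj_bij (A B : Type) (f : A -> B) :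
  injective f -> surj f -> bijective f.
Proof.
move=> fI /choice[g fg]; exists g => // x.
by apply: fI; rewrite fg.
Qed.

Lemma expg_gcd (G : groupType) (x : G) m n :
  x ^+ m = 1 -> x ^+ n = 1 -> x ^+ gcdn m n = 1.
Proof.
case: m => [|m] xm xn; first by rewrite gcd0n.
case: (egcdnP n (ltn0Sn m)) => km kn e _.
have: x ^+ (km * m.+1) = 1 by rewrite mulnC expgnA xm expg1n.
by rewrite e expgnDr mulnC expgnA xn expg1n mul1g.
Qed.

Lemma has_order_exists (G : groupType) (x : G) n :
  (0 < n)%N -> x ^+ n = 1 -> exists m, has_order x m.
Proof.
move=> n0 xn.
have ex : exists m, (0 < m)%N && (x ^+ m == 1).
  by exists n; rewrite n0 xn eqxx.
case: (ex_minnP ex) => m /andP[m0 /eqP xm] mmin.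
by exists m; split=> // k k0 xk; apply: mmin; rewrite k0 xk eqxx.
Qed.

Lemma has_order_dvdn (G : groupType) (x : G) n m :
  has_order x n -> x ^+ m = 1 -> (n %| m)%N.
Proof.
move=> [n0 xn nmin] xm.
have g0 : (0 < gcdn n m)%N by rewrite gcdn_gt0 n0.
have := nmin _ g0 (expg_gcd xn xm).
by move=> le; apply/gcdn_idPl/eqP; rewrite eqn_leq le dvdn_leq // dvdn_gcdl.
Qed.

Lemma primary_componentP p (G : groupType) (x : G) : prime p ->
  primary_component p x <-> exists k, x ^+ (p ^ k)%N = 1.
Proof.
move=> pp; split=> [[k [_ xk _]]|[k xk]]; first by exists k.
have pk0 : (0 < p ^ k)%N by rewrite expn_gt0 prime_gt0.
have [n xn] := has_order_exists pk0 xk.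
have /(dvdn_pfactor _ _ pp)[j _ nE] := has_order_dvdn xn xk.
by exists j; rewrite -nE.
Qed.

(** Subgroups are [Prop]-valued predicates, so that they can be defined by
    arbitrary quantification; [group_closed_asbool] converts them into boolean
    ones. *)
Definition subgp (G : groupType) (K : G -> Prop) : Prop :=
  K 1 /\ forall x y, K x -> K y -> K (x / y).

(** The cyclic subgroup generated by [z]: exponents are natural numbers, and a
    quotient of two powers encodes an integer exponent. *)
Definition powers (G : groupType) (z w : G) : Prop :=
  exists i j, w = z ^+ i / z ^+ j.

Definition join (G : groupType) (K L : G -> Prop) (x : G) : Prop :=
  exists k l, [/\ K k, L l & x = k * l].

Section Subgroups.
Variables (G : groupType) (K : G -> Prop).
Hypothesis sK : subgp K.

Lemma subgp1 : K 1. Proof. by case: sK. Qed.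

Lemma subgpF x y : K x -> K y -> K (x / y). Proof. exact: sK.2. Qed.

Lemma subgpV x : K x -> K x^-1.
Proof. by move=> Kx; rewrite -div1g; apply: subgpF => //; exact: subgp1. Qed.

Lemma subgpM x y : K x -> K y -> K (x * y).
Proof. by move=> Kx Ky; rewrite -(invgK y); apply/subgpF/subgpV. Qed.

Lemma subgpX x n : K x -> K (x ^+ n).
Proof.
move=> Kx; elim: n => [|n IH]; first by rewrite expg0; exact: subgp1.
by rewrite expgS; exact: subgpM.
Qed.

Lemma powers_sub z : K z -> forall w, powers z w -> K w.
Proof. by move=> Kz _ [i [j ->]]; apply: subgpF; exact: subgpX. Qed.

Lemma group_closed_asbool : group_closed [pred x | `[< K x >]].
Proof.
split; first by apply/asboolP; exact: subgp1.
by move=> x y /asboolP Kx /asboolP Ky; exact/asboolP/subgpF.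
Qed.

End Subgroups.

Lemma trivial_subgp (G : groupType) : subgp (fun x : G => x = 1).
Proof. by split=> // x y -> ->; rewrite divg1. Qed.

(** By Bezout, [x] is a product of a power of [x ^+ m] and one of [x ^+ n]. *)
Lemma subgp_coprime (G : groupType) (K : G -> Prop) x m n :
  subgp K -> coprime m n -> K (x ^+ m) -> K (x ^+ n) -> K x.
Proof.
case: m => [|m] sK c Km Kn.
  by move: c Kn; rewrite /coprime gcd0n => /eqP ->; rewrite expg1.
case: (egcdnP n (ltn0Sn m)) => a b e _; move/eqP: c e => -> e.
have -> : x = x ^+ (a * m.+1) / x ^+ (b * n).
  by rewrite e addnC expgnDr expg1 mulgK.
by rewrite mulnC (mulnC b) !expgnA; apply: subgpF => //; exact: subgpX.
Qed.

Lemma coprime_expg_eq1 (G : groupType) (x : G) m n :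
  coprime m n -> x ^+ m = 1 -> x ^+ n = 1 -> x = 1.
Proof. exact: (subgp_coprime (trivial_subgp G)). Qed.

Lemma powers_id (G : groupType) (z : G) : powers z z.
Proof. by exists 1%N, 0%N; rewrite expg0 expg1 divg1. Qed.

Lemma powers_subgp (G : groupType) (z : G) : subgp (powers z).
Proof.
have cz m n : commute (z ^+ m) (z ^+ n) by exact: commuteX2.
split; first by exists 0%N, 0%N; rewrite expg0 divg1.
move=> _ _ [i [j ->]] [k [l ->]]; exists (i + l)%N, (k + j)%N.
rewrite invgF !expgnDr invgM -!mulgA; congr (_ * _).
rewrite mulgA [RHS]mulgA; congr (_ * _).
exact/commute_sym/commuteV/cz.
Qed.

(** * Quotients, subgroup types and homomorphisms *)

Section Quotient.
Local Open Scope quotient_scope.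
Variables (G : groupType) (K : G -> Prop).
Hypotheses (abG : abelian_group G) (sK : subgp K).

Definition cong (x y : G) : bool := `[< K (x / y) >].

Lemma cong_equiv_class : equiv_class_of cong.
Proof.
split=> [x|x y|y x z].
- by apply/asboolP; rewrite mulgV; exact: subgp1.
- by apply/asboolP/asboolP => /(subgpV sK); rewrite invgF.
- move=> /asboolP Kxy /asboolP Kyz; apply/asboolP.
  by rewrite -(mulgVK y x) -mulgA; exact: subgpM.
Qed.

Canonical cong_equiv := EquivRelPack cong_equiv_class.

Definition quotient_group : Type := {eq_quot cong_equiv}.

HB.instance Definition _ := Choice.on quotient_group.

Definition proj (x : G) : quotient_group := \pi_{eq_quot cong_equiv} x.

Lemma projK x : K (repr (proj x) / x).
Proof. by have /eqmodP/asboolP := reprK (proj x). Qed.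

Lemma proj_eq x y : K (x / y) -> proj x = proj y.
Proof. by move=> Kxy; apply/eqmodP/asboolP. Qed.

Lemma projP a : exists x, a = proj x.
Proof. by exists (repr a); rewrite /proj reprK. Qed.

Definition quot_mul (a b : quotient_group) := proj (repr a * repr b).
Definition quot_inv (a : quotient_group) := proj (repr a)^-1.

Lemma projM x y : proj (x * y) = quot_mul (proj x) (proj y).
Proof.
apply/esym/proj_eq.
rewrite invgM mulgA -(mulgA (repr _)) -(mulgA (repr _)).
rewrite (abG (repr (proj y) / y) x^-1) mulgA.
by apply: (subgpM sK); exact: projK.
Qed.

Lemma projV x : proj x^-1 = quot_inv (proj x).
Proof. by apply: proj_eq; rewrite invgK abG; exact: projK. Qed.

Fact quot_mulA : associative quot_mul.
Proof.
move=> a b c; have [x ->] := projP a; have [y ->] := projP b.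
have [z ->] := projP c; rewrite -!projM mulgA //.
Qed.
Fact quot_mul1 : left_id (proj 1) quot_mul.
Proof. by move=> a; have [x ->] := projP a; rewrite -!projM mul1g. Qed.
Fact quot_1mul : right_id (proj 1) quot_mul.
Proof. by move=> a; have [x ->] := projP a; rewrite -!projM mulg1. Qed.
Fact quot_mulV : left_inverse (proj 1) quot_inv quot_mul.
Proof. by move=> a; have [x ->] := projP a; rewrite -projV -!projM mulVg. Qed.
Fact quot_Vmul : right_inverse (proj 1) quot_inv quot_mul.
Proof. by move=> a; have [x ->] := projP a; rewrite -projV -!projM mulgV. Qed.

HB.instance Definition _ := isGroup.Build quotient_group
  quot_mulA quot_mul1 quot_1mul quot_mulV quot_Vmul.

HB.instance Definition _ := isMultiplicative.Build G quotient_group proj projM.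

Lemma quotient_exists : exists (Q : groupType) (f : {multiplicative G -> Q}),
  surj f /\ forall x, f x = 1 <-> K x.
Proof.
exists quotient_group, proj; split=> [q|x].
  by exists (repr q); exact: reprK.
split=> [|Kx]; last by apply: proj_eq; rewrite divg1.
by move/eqmodP/asboolP; rewrite divg1.
Qed.

End Quotient.

Section Subtype.
Variables (G : groupType) (K : G -> Prop).
Hypothesis (sK : subgp K).

Definition sub_pred : pred G := [pred x | `[< K x >]].

Record sub_type : Type := SubElt { sub_val : G; _ : sub_pred sub_val }.

HB.instance Definition _ := [isSub for sub_val].
HB.instance Definition _ := [Choice of sub_type by <:].
HB.instance Definition _ :=
  SubChoice_isSubGroup.Build G sub_pred sub_type (group_closed_asbool sK).

Lemma subgroup_exists : exists (S : pred G) (H : subGroupType S),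
  forall x, K x <-> exists h : H, val h = x.
Proof.
exists sub_pred, sub_type => x; split=> [Kx|[[y Ky] <-]]; last exact/asboolP.
by exists (SubElt (introT (asboolP _) Kx : sub_pred x)).
Qed.

End Subtype.

(** The corresponding library lemmas are about unital morphisms; between groups,
    preservation of 1 follows from that of products. *)
Section Homomorphisms.
Variables (G H : groupType) (f : {multiplicative G -> H}).

Lemma hom1 : f 1 = 1.
Proof. by apply: (mulgI (f 1)); rewrite -gmulfM !mulg1. Qed.

Lemma homV x : f x^-1 = (f x)^-1.
Proof. by apply: (mulgI (f x)); rewrite -gmulfM !mulgV hom1. Qed.

Lemma homF x y : f (x / y) = f x / f y.
Proof. by rewrite gmulfM homV. Qed.

Lemma homX x n : f (x ^+ n) = f x ^+ n.
Proof.
by elim: n => [|n IH]; [rewrite !expg0 hom1 | rewrite !expgS gmulfM IH].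
Qed.

End Homomorphisms.

Lemma morph_exists (G H : groupType) (f : G -> H) :
  {morph f : x y / x * y} -> exists g : {multiplicative G -> H}, g =1 f.
Proof.
move=> fM; pose m := isMultiplicative.Build G H f fM.
by exists (HB.pack_for {multiplicative G -> H} f m).
Qed.

Lemma isomorphic_sym (G H : groupType) : isomorphic G H -> isomorphic H G.
Proof.
move=> [f [g gK fK]].
have [h hE] := morph_exists (can2_gmulfM gK fK).
by exists h, f => x; rewrite hE ?fK ?gK.
Qed.

(** * Root classes of periodic groups *)

Lemma root_class_embed (C : groupType -> Prop) (G H : groupType)
    (f : {multiplicative H -> G}) :
  root_class C -> injective f -> C G -> C H.
Proof.
move=> rC fI CG.
have sK : subgp (fun x => exists h, f h = x).
  split; first by exists 1; rewrite hom1.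
  by move=> _ _ [x <-] [y <-]; exists (x / y); rewrite homF.
have [S [I IE]] := subgroup_exists sK.
have /choice[g gE] : forall h, exists i : I, val i = f h.
  by move=> h; apply/IE; exists h.
have gM : {morph g : x y / x * y}.
  by move=> x y; apply: val_inj; rewrite valM !gE gmulfM.
have [g' g'E] := morph_exists gM.
apply: (root_isom rC _ (root_sub rC I CG)); apply: isomorphic_sym.
exists g'; apply: inj_surj_bij => [x y|i].
  by rewrite !g'E => /(congr1 val); rewrite !gE => /fI.
have [h hE] : exists h, f h = val i by apply/IE; exists i.
by exists h; apply: val_inj; rewrite g'E gE.
Qed.

Lemma cart_expg (I : Type) (F : I -> groupType) (f : cartesian_product F) n i :
  (f ^+ n) i = f i ^+ n.
Proof. by elim: n => [|n IH]; rewrite ?expg0 // !expgS -IH. Qed.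

(** The identity map, as an element of the Cartesian power of [G] indexed by
    [G], has finite order, and every element of [G] is one of its components. *)
Lemma root_class_exponent (C : groupType -> Prop) (G : groupType) :
  root_class C -> periodic_class C -> C G ->
  exists2 m, (0 < m)%N & forall x : G, x ^+ m = 1.
Proof.
move=> rC pC CG.
have iso (y : G) : isomorphic G G by exists idfun; exists id.
have /pC/(_ (fun x : G => x))[m [m0 dm _]] := root_prod rC CG CG iso.
exists m => // x.
by have := cart_expg (F := fun=> G) (fun y => y) m x; rewrite dm => <-.
Qed.

(** * Cyclic groups *)

Definition generates (G : groupType) (z : G) : Prop :=
  forall w, exists i, w = z ^+ i.

Lemma has_order_modX (G : groupType) (z : G) n i :
  has_order z n -> z ^+ (i %% n) = z ^+ i.
Proof.
move=> [_ zn _]; rewrite [in RHS](divn_eq i n) expgnDr mulnC expgnA zn.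
by rewrite expg1n mul1g.
Qed.

Lemma has_order_eqX (G : groupType) (z : G) n i j :
  has_order z n -> z ^+ i = z ^+ j -> i = j %[mod n].
Proof.
move=> oz; wlog ij : i j / (i <= j)%N => [W e|].
  by case: (leqP i j) => [|/ltnW] ij; [exact: W | apply/esym/W].
rewrite -(subnKC ij) expgnDr -[in LHS](mulg1 (z ^+ i)) => /mulgI/esym.
move/(has_order_dvdn oz) => d; apply/esym/eqP.
by rewrite eqn_mod_dvd ?leq_addr // addKn.
Qed.

Lemma cyclic_hom (G : groupType) (z : G) n : has_order z n.+1 ->
  exists2 f : {multiplicative 'I_n.+1 -> G}, injective f & forall i, f i = z ^+ i.
Proof.
move=> oz.
have fM : {morph (fun i : 'I_n.+1 => z ^+ i) : x y / x * y}.
  by move=> i j /=; rewrite has_order_modX // expgnDr.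
have [f fE] := morph_exists fM; exists f => // i j; rewrite !fE.
move/(has_order_eqX oz); rewrite !modn_small //; exact: val_inj.
Qed.

Lemma cyclic_isomorphic (G : groupType) (z : G) n :
  has_order z n.+1 -> generates z -> isomorphic 'I_n.+1 G.
Proof.
move=> oz gz; have [f fI fE] := cyclic_hom oz.
exists f; apply: inj_surj_bij => // w; have [i ->] := gz w.
by exists (inord (i %% n.+1)); rewrite fE inordK ?ltn_mod // has_order_modX.
Qed.

Lemma has_order_prime (G : groupType) (z : G) p :
  prime p -> z ^+ p = 1 -> z <> 1 -> has_order z p.
Proof.
move=> pp zp z1; split=> // [|m m0 zm]; first exact: prime_gt0.
rewrite leqNgt; apply/negP => mp; apply: z1.
apply: (coprime_expg_eq1 _ zp zm).
by rewrite prime_coprime // gtnNdvd.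
Qed.

Lemma class_primes_element (C : groupType -> Prop) p : class_primes C p ->
  exists2 G : groupType, C G & exists g : G, has_order g p.
Proof.
move=> [pp [G CG [x [n [[n0 xn nmin] pn]]]]]; exists G => //.
have np0 : (0 < n %/ p)%N by rewrite divn_gt0 ?prime_gt0 // dvdn_leq.
exists (x ^+ (n %/ p)); apply: has_order_prime => //.
  by rewrite -expgnA divnK.
move=> /(nmin _ np0); rewrite leqNgt ltn_Pdiv ?prime_gt1 //.
Qed.

Lemma generates_abelian (G : groupType) (z : G) : generates z -> abelian_group G.
Proof.
by move=> gz x y; have [i ->] := gz x; have [j ->] := gz y; exact: commuteX2.
Qed.

Lemma powers_finite (G : groupType) (z w : G) n :
  (0 < n)%N -> z ^+ n = 1 -> powers z w -> exists i, w = z ^+ i.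
Proof.
move=> n0 zn [i [j ->]]; exists (i + n.-1 * j)%N.
rewrite expgnDr; congr (_ * _); apply: mulg1_eq.
rewrite -expgnDr -mulSn prednK //.
by rewrite expgnA zn expg1n.
Qed.

Lemma finite_pgroup_cyclic (G : groupType) (z : G) p m :
  prime p -> generates z -> z ^+ (p ^ m) = 1 -> finite_pgroup p G.
Proof.
move=> pp gz zm.
have pm0 : (0 < p ^ m)%N by rewrite expn_gt0 prime_gt0.
have [[[//]|n] oz] := has_order_exists pm0 zm.
exists 'I_n.+1; last exact: cyclic_isomorphic gz.
rewrite /pgroup cardsT card_ord.
apply: pnat_dvd (has_order_dvdn oz zm) _.
by rewrite pnatX pnat_id.
Qed.

(** A group of order [p] embeds into any group of [C] that has an element of
    order [p]; the trivial group embeds into any group. *)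
Lemma root_class_prime_cyclic (C : groupType -> Prop) (G : groupType) (z : G) p :
  root_class C -> class_primes C p -> generates z -> z ^+ p = 1 -> C G.
Proof.
move=> rC Cp gz zp; have [H CH [g og]] := class_primes_element Cp.
have [pp _] := Cp; move: pp zp og; case: p Cp => // n Cp pp zp og.
have [z1|z1] := pselect (z = 1).
  have cM : {morph (fun _ : G => 1 : H) : x y / x * y}.
    by move=> x y; rewrite mulg1.
  have [f _] := morph_exists cM.
  apply: (root_class_embed (f := f) rC _ CH) => x y _.
  by have [i ->] := gz x; have [j ->] := gz y; rewrite z1 !expg1n.
have oz := has_order_prime pp zp z1.
apply: (root_isom rC (cyclic_isomorphic oz gz)).
by have [f fI _] := cyclic_hom og; exact: (root_class_embed rC fI CH).
Qed.

(** With [u := z ^+ (p ^ m)], the group is an extension of the subgroup of the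
    powers of [u], whose exponent divides [p], by a cyclic group whose generator
    is killed by [p ^ m]. *)
Lemma root_class_cyclic (C : groupType -> Prop) (G : groupType) (z : G) p m :
  root_class C -> class_primes C p -> generates z -> z ^+ (p ^ m) = 1 -> C G.
Proof.
move=> rC Cp; have [pp _] := Cp.
elim: m G z => [|m IH] G z gz zm.
  apply: (root_class_prime_cyclic rC Cp gz).
  by move: zm; rewrite expg1 => ->; rewrite expg1n.
pose u := z ^+ (p ^ m).
have up : u ^+ p = 1 by rewrite -expgnA -expnSr.
have su := powers_subgp u.
have [S [N NE]] := subgroup_exists su.
have [v vE] : exists v : N, val v = u by apply/NE; exact: powers_id.
have valX (x : N) k : val (x ^+ k) = val x ^+ k by exact: homX.
have CN : C N.
  apply: (root_class_prime_cyclic (z := v) rC Cp).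
    move=> w; have /NE/(powers_finite (prime_gt0 pp) up)[i wE] :
      exists h : N, val h = val w by exists w.
    by exists i; apply: val_inj; rewrite valX vE.
  by apply: val_inj; rewrite valX vE up val1.
have [Q [f [sf fE]]] := quotient_exists (generates_abelian gz) su.
have CQ : C Q.
  apply: (IH _ (f z)) => [q|].
    by have [x <-] := sf q; have [i ->] := gz x; exists i; exact: homX.
  by rewrite -homX; apply/fE; exact: powers_id.
apply: (root_ext rC _ CN CQ).
exists val, f; split=> [|//|e]; first exact: val_inj.
by rewrite fE NE.
Qed.

(** * Separability bounds the primary components *)

Lemma join_subgp (G : groupType) (K L : G -> Prop) : abelian_group G ->
  subgp K -> subgp L -> subgp (join K L).
Proof.
move=> ab sK sL; split.
  by exists 1, 1; rewrite mulg1; split=> //; exact: subgp1.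
move=> _ _ [k [l [Kk Ll ->]]] [k' [l' [Kk' Ll' ->]]].
exists (k / k'), (l / l'); split; [exact: subgpF | exact: subgpF |].
by rewrite invgM (ab l'^-1) -!mulgA; congr (_ * _); rewrite !mulgA (ab l).
Qed.

Lemma joinl (G : groupType) (K L : G -> Prop) x : subgp L -> K x -> join K L x.
Proof. by move=> sL Kx; exists x, 1; rewrite mulg1; split=> //; exact: subgp1. Qed.

Lemma joinr (G : groupType) (K L : G -> Prop) x : subgp K -> L x -> join K L x.
Proof. by move=> sK Lx; exists 1, x; rewrite mul1g; split=> //; exact: subgp1. Qed.

Lemma quotient_abelian (G Q : groupType) (f : {multiplicative G -> Q}) :
  surj f -> abelian_group G -> abelian_group Q.
Proof.
move=> sf ab x y; have [a <-] := sf x; have [b <-] := sf y.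
by rewrite /commute -!gmulfM ab.
Qed.

(** Let [I] be the isolator in [X] of the preimage of [K].  A preimage [x] of [u]
    is outside [I], as [u] has order [p] modulo [K], so a homomorphism to some
    group of [C], of exponent [m], separates [x] from [I].  For [t] of p-power
    order, [t ^+ (p ^ logn p m)] is an [m]-th power, so it lifts to an element of
    the kernel of that homomorphism; hence [u] cannot be congruent to it modulo
    [K]. *)
Lemma Sep_padically_closed (C : groupType -> Prop) (X B : groupType)
    (f : {multiplicative X -> B}) (p : nat) (K : B -> Prop) (u : B) :
  root_class C -> periodic_class C -> abelian_group X -> Sep C X -> surj f ->
  class_primes C p -> subgp K -> K (u ^+ p) -> ~ K u ->
  exists n, forall t k, t ^+ (p ^ k) = 1 -> ~ K (u / t ^+ (p ^ n)).
Proof.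
move=> rC pC abX SepX sf Cp sK Kup Ku; have [pp _] := Cp.
(* The exponents [r] are the P'-numbers. *)
pose I x := exists r, [/\ (0 < r)%N,
  forall q, prime q -> (q %| r)%N -> ~ class_primes C q & K (f x ^+ r)].
have sI : subgp I.
  split.
    exists 1%N; split=> // [q pq|]; last by rewrite hom1 expg1n; exact: subgp1.
    by rewrite dvdn1 => /eqP q1; move: pq; rewrite q1.
  move=> x y [r [r0 rP Kr]] [s [s0 sP Ks]]; exists (r * s)%N.
  split; first by rewrite muln_gt0 r0.
    by move=> q pq; rewrite Euclid_dvdM // => /orP[]; [exact: rP | exact: sP].
  rewrite homF expgnFl; last exact: (quotient_abelian sf abX).
  apply: subgpF => //; first by rewrite expgnA; exact: subgpX.
  by rewrite mulnC expgnA; exact: subgpX.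
have IK x : K (f x) -> I x.
  move=> Kx; exists 1%N; split=> // q pq.
  by rewrite dvdn1 => /eqP q1; move: pq; rewrite q1.
have isoI : isolated (prime_compl (class_primes C)) [pred x | `[< I x >]].
  move=> x q [pq nCq] /asboolP[r [r0 rP Kr]]; apply/asboolP.
  exists (q * r)%N; split; first by rewrite muln_gt0 prime_gt0.
    move=> l pl; rewrite Euclid_dvdM // => /orP[|]; last exact: rP.
    by rewrite dvdn_prime2 // => /eqP ->.
  by rewrite expgnA -homX.
have [x fx] := sf u.
have Ix : x \notin [pred x | `[< I x >]].
  apply/negP => /asboolP[r [r0 rP Kr]]; apply: Ku.
  have cpr : coprime r p.
    rewrite coprime_sym prime_coprime //; apply/negP => pr; exact: (rP p pp pr Cp).
  apply: (subgp_coprime sK cpr) => //; by rewrite -fx.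
have [G CG [s ss sx]] := SepX _ (group_closed_asbool sI) isoI _ Ix.
have [m m0 mG] := root_class_exponent rC pC CG.
exists (logn p m) => t k tk Kut; apply: sx.
have [c cm mE] := pfactor_coprime pp m0.
have [y fy] := sf t.
have c0 : (0 < c)%N by move: m0; rewrite mE muln_gt0 => /andP[].
have cpk : coprime c (p ^ k) by rewrite coprime_sym coprimeXl.
case: (egcdnP (p ^ k) c0) => a b e _; move/eqP: cpk e => -> e.
(* As [a * c = b * p ^ k + 1], the element [t ^+ (a * m)] is
   [t ^+ (p ^ logn p m)]. *)
exists (x / y ^+ (a * m)).
  apply/asboolP/IK; rewrite homF homX fx fy mE mulnA e mulnDl mul1n.
  rewrite expgnDr -mulnA mulnCA expgnA tk expg1n mul1g //.
by rewrite homF homX mulnC expgnA mG expg1n divg1.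
Qed.

(** Say that [x] has level [i] when [S i x].  Choose [idx 0 < idx 1 < ...] and
    elements [U n] of level [idx n] that are not of level [idx n.+1].  The
    subgroup [K] generated by the quotients [U n / U n.+1] contains [U 0 / U n]
    for all [n].  It omits [U 0] because its part [Kn n], generated by the first
    [n] quotients, meets level [idx n] trivially: if [U 0] were in [Kn n], so
    would be [U n], which has that level and is not trivial. *)
Lemma exists_nonclosed_subgroup (B : groupType) (S : nat -> B -> Prop) p :
  abelian_group B -> prime p ->
  (forall i, subgp (S i)) -> (forall i x, S i.+1 x -> S i x) ->
  (forall i x, S i x -> x ^+ p = 1) ->
  (forall i, exists2 u, u <> 1 & S i u) ->
  (forall u, u <> 1 -> exists n, ~ S n u) ->
  exists (K : B -> Prop) u,
    [/\ subgp K, K (u ^+ p), ~ K u & forall n, exists2 s, S n s & K (u / s)].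
Proof.
move=> abB pp sS decS expS exS sepS.
have mono i j x : (i <= j)%N -> S j x -> S i x.
  by move=> ij; rewrite -(subnK ij); elim: (j - i)%N => // d IH /decS.
have /choice[F FP] : forall i, exists uj : B * nat, S i uj.1 /\ ~ S uj.2 uj.1.
  move=> i; have [u u1 Su] := exS i; have [n Sn] := sepS u u1.
  by exists (u, n).
pose idx n := iter n (fun i => (F i).2) 0%N.
pose U n := (F (idx n)).1.
have SU n : S (idx n) (U n) by case: (FP (idx n)).
have nSU n : ~ S (idx n.+1) (U n) by case: (FP (idx n)).
have idxS n : (idx n < idx n.+1)%N.
  by rewrite ltnNge; apply/negP => /mono le; apply: (nSU n); apply: le.
have idx_ge n : (n <= idx n)%N.
  by elim: n => // n IH; exact: leq_ltn_trans (idxS n).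
pose fix Kn n : B -> Prop :=
  if n is n'.+1 then join (Kn n') (powers (U n' / U n'.+1)) else fun x => x = 1.
have sKn n : subgp (Kn n).
  elim: n => [|n IH]; first exact: trivial_subgp.
  exact: join_subgp (powers_subgp _).
have monoK i j x : (i <= j)%N -> Kn i x -> Kn j x.
  move=> ij; rewrite -(subnK ij); elim: (j - i)%N => // d IH /IH Kx.
  by apply: joinl => //; exact: powers_subgp.
have KU n : Kn n (U 0%N / U n).
  elim: n => [|n IH]; first by rewrite mulgV; exact: subgp1.
  exists (U 0%N / U n), (U n / U n.+1); split=> //; first exact: powers_id.
  by rewrite mulgA mulgVK.
(* If [k * (U n / U n.+1) ^+ e] has level [idx n.+1], so has [k * U n ^+ e]; then
   [k] has level [idx n], so it is trivial, and [p] divides [e] since [U n] does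
   not have level [idx n.+1]. *)
have KS n : forall x, Kn n x -> S (idx n) x -> x = 1.
  have Up m : U m ^+ p = 1 by apply: expS (SU m).
  elim: n => [|n IH] x //= [k [w [Kk]]].
  have vp : (U n / U n.+1) ^+ p = 1 by rewrite expgnFl // !Up divg1.
  move=> /(powers_finite (prime_gt0 pp) vp)[e ->] -> Sx.
  have SkU : S (idx n.+1) (k * U n ^+ e).
    have -> : k * U n ^+ e = k * (U n / U n.+1) ^+ e * U n.+1 ^+ e.
      by rewrite expgnFl // mulgA mulgVK.
    by apply: subgpM => //; exact: subgpX.
  have k1 : k = 1.
    apply: IH => //; rewrite -(mulgK (U n ^+ e) k).
    by apply: subgpF => //; [exact: mono (ltnW (idxS n)) SkU | exact: subgpX].
  have [pe|npe] := boolP (p %| e)%N.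
    by rewrite k1 mul1g -(divnK pe) mulnC expgnA vp expg1n.
  case: (nSU n); apply: (subgp_coprime (m := e) (n := p) (sS _)).
  - by rewrite coprime_sym prime_coprime.
  - by move: SkU; rewrite k1 mul1g.
  - by rewrite Up; exact: subgp1.
have sK : subgp (fun x => exists n, Kn n x).
  split; first by exists 0%N.
  move=> x y [m Kx] [n Ky]; exists (maxn m n).
  apply: subgpF => //; first by apply: monoK Kx; exact: leq_maxl.
  by apply: monoK Ky; exact: leq_maxr.
exists (fun x => exists n, Kn n x), (U 0%N); split=> //.
- by exists 0%N; rewrite (expS _ _ (SU 0%N)).
- move=> [n KU0]; case: (nSU n).
  have -> : U n = 1.
    apply: (KS n) => //; rewrite -(divKg (abB (U 0%N) (U n))).
    exact: subgpF.
  exact: subgp1.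
- by move=> n; exists (U n); [exact: mono (idx_ge n) (SU n) | exists n].
Qed.

Lemma Sep_weakly_bounded (C : groupType -> Prop) (X : groupType) :
  root_class C -> periodic_class C -> abelian_group X ->
  Sep C X -> weakly_bounded C X.
Proof.
move=> rC pC abX SepX B [f sf] p Cp; have [pp _] := Cp.
have abB := quotient_abelian sf abX.
have cB (x y : B) : commute x y by exact: abB.
apply: contrapT => unb.
pose S i (s : B) := s ^+ p = 1 /\
  exists t, (exists k, t ^+ (p ^ k) = 1) /\ s = t ^+ (p ^ i).
have sS i : subgp (S i).
  split.
    split; first exact: expg1n.
    by exists 1; split; [exists 0%N; rewrite expg1n | rewrite expg1n].
  move=> x y [xp [t [[k tk] xE]]] [yp [t' [[k' tk'] yE]]]; split.
    by rewrite expgnFl // xp yp divg1.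
  exists (t / t'); rewrite xE yE -expgnFl //; split=> //; exists (k + k')%N.
  by rewrite expgnFl // expnD expgnA tk mulnC expgnA tk' !expg1n divg1.
(* An element of all the [S n] would be in the closure of the trivial
   subgroup. *)
have noninf u : u <> 1 -> exists n, ~ S n u.
  move=> u1; have [up|nup] := pselect (u ^+ p = 1); last by exists 0%N => -[].
  have [n nP] := Sep_padically_closed rC pC abX SepX sf Cp (trivial_subgp B) up u1.
  by exists n => -[_ [t [[k tk] uE]]]; apply: (nP _ _ tk); rewrite uE mulgV.
have [|||K [u [sK Kup Ku KP]]] :=
  @exists_nonclosed_subgroup B S p abB pp sS _ _ _ noninf.
- move=> i x; case=> xp [t [[k tk] xE]]; split=> //; exists (t ^+ p); split.
    by exists k; rewrite expgnAC tk expg1n.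
  by rewrite xE expnS expgnA.
- by move=> i x [].
- move=> i; apply: contrapT => trivS; apply: unb.
  exists (p ^ i)%N; first by rewrite expn_gt0 prime_gt0.
  move=> x [k [_ xk _]].
  elim: k xk => [|k IH] xk; first by rewrite -(expg1 x) xk expg1n.
  have [le|lt] := leqP k.+1 i.
    by rewrite -(subnKC le) expnD expgnA xk expg1n.
  apply: IH; apply: contrapT => xk1; apply: trivS.
  exists (x ^+ (p ^ k)) => //; split; first by rewrite -expgnA -expnSr.
  exists (x ^+ (p ^ (k - i))); split; last by rewrite -expgnA -expnD subnK.
  by exists k.+1; rewrite expgnAC xk expg1n.
have [n nP] := Sep_padically_closed rC pC abX SepX sf Cp sK Kup Ku.
have [s [sp [t [[k tk] ->]]] Kus] := KP n.
exact: nP tk Kus.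
Qed.

(** * Bounded primary components give separability *)

(** If [b] is a power of [b ^+ p] for some [p] in [P], then its order is finite
    and prime to [p].  When this holds for all [p] in [P], the order has no prime
    factor in [P], nor outside [P] since there is no torsion for such primes. *)
Lemma prime_not_power (B : groupType) (P : nat -> Prop) (b : B) :
  (forall p, P p -> prime p) -> (exists p, P p) -> b <> 1 ->
  (forall q (x : B), prime q -> ~ P q -> x ^+ q = 1 -> x = 1) ->
  exists2 p, P p & ~ powers (b ^+ p) b.
Proof.
move=> Pp [p0 P0] b1 tf.
have key p : P p -> powers (b ^+ p) b ->
    exists2 n, coprime p n & (0 < n)%N /\ b ^+ n = 1.
  move=> /Pp pp [i [j]]; rewrite -!expgnA => bE.
  have e : b ^+ (p * i) = b ^+ (p * j).+1.
    by rewrite expgS -[LHS](mulgVK (b ^+ (p * j))) -bE.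
  have cop n : (p %| n -> p %| (p * j).+1)%N -> coprime p n.
    move=> pn; rewrite prime_coprime //; apply/negP => /pn.
    by rewrite -addn1 dvdn_addr ?dvdn_mulr // dvdn1 => /eqP p1; move: pp; rewrite p1.
  have [n cn bn] : exists2 n, coprime p n & b ^+ n = 1.
    have [le|/ltnW le] := leqP (p * i) (p * j).+1.
      exists ((p * j).+1 - p * i)%N; last by rewrite expgnFr // e mulgV.
      by apply: cop => pn; rewrite -(subnK le) dvdn_addr // dvdn_mulr.
    exists (p * i - (p * j).+1)%N; last by rewrite expgnFr // e mulgV.
    by apply: cop => pn; rewrite -(dvdn_addr _ pn) subnK // dvdn_mulr.
  exists n => //; split=> //; case: n cn {bn} => //.
  by rewrite prime_coprime // dvdn0.
apply: contrapT => nex.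
have all p : P p -> powers (b ^+ p) b.
  by move=> Pq; apply: contrapT => np; apply: nex; exists p.
have [n _ [n0 bn]] := key _ P0 (all _ P0).
have [N oN] := has_order_exists n0 bn; have [N0 bN Nmin] := oN.
have N1 : (1 < N)%N.
  rewrite ltn_neqAle N0 andbT; apply/eqP => N1; apply: b1.
  by rewrite -N1 expg1 in bN.
pose q := pdiv N; have pq := pdiv_prime N1.
have Pq : P q.
  apply: contrapT => nPq.
  have /Nmin : b ^+ (N %/ q) = 1.
    by apply: (tf q) => //; rewrite -expgnA divnK // pdiv_dvd.
  rewrite divn_gt0 ?prime_gt0 // dvdn_leq ?pdiv_dvd // => /(_ isT).
  by rewrite leqNgt ltn_Pdiv ?prime_gt1.
have [m cm [m0 bm]] := key _ Pq (all _ Pq).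
have := coprime_dvdr (has_order_dvdn oN bm) cm.
by rewrite prime_coprime // pdiv_dvd.
Qed.

Lemma maximal_avoiding (G : groupType) (H : G -> Prop) (b : G) :
  subgp H -> ~ H b ->
  exists M, [/\ subgp M, forall x, H x -> M x, ~ M b &
    forall L, subgp L -> (forall x, M x -> L x) -> ~ L b ->
      forall x, L x -> M x].
Proof.
move=> sH Hb.
(* Adjoining [H] lets the empty chain have the upper bound [H]. *)
pose P (A : set G) := subgp (A `|` H)%classic /\ ~ (A `|` H)%classic b.
have [F FP Ftot|A [[sA Ab] Amax]] := @Zorn_bigcup G P.
  have bigE x : (\bigcup_(Y in F) Y `|` H)%classic x ->
      H x \/ exists2 Y, F Y & Y x.
    by move=> [[Y FY Yx]|]; [right; exists Y | left].
  split; last by move=> /bigE[//|[Y FY Yb]]; case: (FP _ FY) => _; apply; left.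
  split; first by right; exact: subgp1.
  have big Y x : F Y -> (Y `|` H)%classic x -> (\bigcup_(Y in F) Y `|` H)%classic x.
    by move=> FY [Yx|]; [left; exists Y | right].
  have sF Y : F Y -> subgp (Y `|` H)%classic by move=> /FP[].
  move=> x y /bigE[Hx|[Y FY Yx]] /bigE[Hy|[Z FZ Zy]].
  - by right; exact: subgpF.
  - by apply: (big Z) => //; apply: (subgpF (sF _ FZ)); [right | left].
  - by apply: (big Y) => //; apply: (subgpF (sF _ FY)); [left | right].
  - have [le|le] := Ftot _ _ FY FZ.
      by apply: (big Z) => //; apply: (subgpF (sF _ FZ)); left => //; exact: le.
    by apply: (big Y) => //; apply: (subgpF (sF _ FY)); left => //; exact: le.
exists (A `|` H)%classic; split=> //; first by move=> x Hx; right.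
move=> L sL AL Lb x Lx; apply: contrapT => Ax; apply: (Amax L).
  split; first by move=> y Ay; apply: AL; left.
  by move=> LA; apply: Ax; left; exact: LA.
have LH : (L `|` H)%classic = L.
  by apply/seteqP; split=> y; [case=> // Hy; apply: AL; right | left].
by rewrite /P LH.
Qed.

(** If [p ^ a.+1] is the exponent, let [z] have that order.  All elements of order
    [p] generate the subgroup of [d], which is contained in the powers of [z].  If
    [w ^+ p] is a power [z ^+ j] of [z], then [p] divides [j] because
    [w ^+ (p ^ a.+1) = 1], so [w] is the product of a power of [z] and of an
    element killed by [p]. *)
Lemma monolithic_cyclic (D : groupType) (d : D) p a :
  abelian_group D -> prime p -> (forall w : D, w ^+ (p ^ a) = 1) ->
  (forall z, z <> 1 -> powers z d) -> d <> 1 -> exists z : D, generates z.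
Proof.
move=> abD pp; elim: a => [|a IH] ea mono d1.
  by exists 1 => w; exists 0%N; rewrite expg0 -[w]expg1; exact: ea.
have [all1|] := pselect (forall w : D, w ^+ (p ^ a) = 1); first exact: IH.
move=> /existsNP[z za]; exists z.
have pa0 : (0 < p ^ a.+1)%N by rewrite expn_gt0 prime_gt0.
have socle v : v ^+ p = 1 -> powers d v.
  have [->|v1] := pselect (v = 1); first by move=> _; exact: subgp1 (powers_subgp d).
  move=> vp; have [i dE] := powers_finite (prime_gt0 pp) vp (mono v v1).
  apply: (subgp_coprime (m := i) (n := p) (powers_subgp d)).
  - rewrite coprime_sym prime_coprime //; apply/negP => pi; apply: d1.
    by rewrite dE -(divnK pi) mulnC expgnA vp expg1n.
  - by rewrite -dE; exact: powers_id.
  - by rewrite vp; exact: subgp1 (powers_subgp d).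
have sz := powers_subgp z.
suff gz w : powers z w by move=> w; exact: powers_finite pa0 (ea z) (gz w).
have : w ^+ (p ^ a.+1) = 1 by [].
elim: (a.+1) w => [|k IHk] w wk.
  by rewrite -(expg1 w) wk; exact: subgp1.
have [j wE] : exists j, w ^+ p = z ^+ j.
  by apply: (powers_finite pa0 (ea z)); apply: IHk; rewrite -expgnA -expnS.
have zaj : z ^+ (p ^ a) ^+ j = 1 by rewrite expgnAC -wE -expgnA -expnS.
have zap : z ^+ (p ^ a) ^+ p = 1 by rewrite -expgnA -expnSr.
have pj : (p %| j)%N.
  apply: contrapT => /negP npj; apply: za; apply: (coprime_expg_eq1 _ zap zaj).
  by rewrite prime_coprime.
have cD (x y : D) : commute x y by exact: abD.
have vp : (w / z ^+ (j %/ p)) ^+ p = 1.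
  by rewrite expgnFl // wE -expgnA divnK // mulgV.
rewrite -(mulgVK (z ^+ (j %/ p)) w); apply: subgpM => //; last first.
  by apply: subgpX => //; exact: powers_id.
apply: (powers_sub sz) (socle _ vp).
apply: (powers_sub sz) (mono _ za).
by apply: subgpX => //; exact: powers_id.
Qed.

(** Both separability properties follow from this one, as the cyclic group [D] is
    a finite [p]-group and belongs to [C]. *)
Lemma cyclic_primary_separation (C : groupType -> Prop) (X : groupType)
    (Y : {pred X}) (x : X) :
  root_class C -> periodic_class C -> abelian_group X -> weakly_bounded C X ->
  group_closed Y -> isolated (prime_compl (class_primes C)) Y -> x \notin Y ->
  exists (D : groupType) (s : {multiplicative X -> D}) (z : D) p m,
    [/\ class_primes C p, surj s, generates z & z ^+ (p ^ m) = 1] /\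
    ~ exists2 y, y \in Y & s y = s x.
Proof.
move=> rC pC abX wbX cY isoY xY.
have sY : subgp (fun y => y \in Y).
  by case: cY => Y1 YF; split=> // u v; exact: YF.
have [B [f [sf fE]]] := quotient_exists abX sY.
have abB := quotient_abelian sf abX.
have cB (u v : B) : commute u v by exact: abB.
pose b := f x.
have b1 : b <> 1 by move/fE; exact/negP.
have [p0 Cp0] : exists p, class_primes C p.
  have [G CG [g g1]] := root_nontrivial rC.
  have [n og] := pC _ CG g; have [n0 gn _] := og.
  exists (pdiv n); split.
    apply: pdiv_prime; rewrite ltn_neqAle n0 andbT; apply/eqP => n1; apply: g1.
    by rewrite -n1 expg1 in gn.
  by exists G => //; exists g, n; split=> //; exact: pdiv_dvd.
have [||||p Cp nb] := @prime_not_power B (class_primes C) b.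
- by move=> p [].
- by exists p0.
- by [].
- move=> q u pq nCq uq; have [v vu] := sf u; rewrite -vu; apply/fE.
  by apply: (isoY v q) => //; apply/fE; rewrite homX vu.
have [pp _] := Cp.
have [Q [g [sg gE]]] := quotient_exists abB (powers_subgp (b ^+ p)).
have QX : quotient_of X Q.
  exists (g \o f) => q; have [u <-] := sg q; have [v <-] := sf u.
  by exists v.
(* A [p ^ a]-th root [t] of [b] would have an image of order dividing
   [p ^ a.+1] in [Q], and the exponent [n] would kill it; then [g b] would be
   killed both by [p] and by the part of [n] prime to [p]. *)
have [n n0 nP] := wbX _ QX _ Cp.
pose a := logn p n.
have sH : subgp (fun w : B => exists t, w = t ^+ (p ^ a)).
  split; first by exists 1; rewrite expg1n.
  by move=> _ _ [t ->] [t' ->]; exists (t / t'); rewrite expgnFl.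
have Hb : ~ exists t, b = t ^+ (p ^ a).
  move=> [t bE].
  have gbp : g b ^+ p = 1 by rewrite -homX; apply/gE; exact: powers_id.
  have [c cc nE] := pfactor_coprime pp n0.
  apply: nb; apply/gE; apply: (coprime_expg_eq1 cc gbp).
  rewrite bE -homX -expgnA mulnC -nE homX; apply: nP.
  apply/(primary_componentP _ pp); exists a.+1.
  by rewrite expnSr expgnA -homX -bE.
have [M [sM HM Mb Mmax]] := maximal_avoiding sH Hb.
have [D [h [sh hE]]] := quotient_exists abB sM.
have abD := quotient_abelian sh abB.
have eD (w : D) : w ^+ (p ^ a) = 1.
  have [v <-] := sh w; rewrite -homX; apply/hE/HM; by exists v.
have hb1 : h b <> 1 by move/hE.
have mono u : u <> 1 -> powers u (h b).
  have [v <-] := sh u => hv1; have sL := join_subgp abB sM (powers_subgp v).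
  apply: contrapT => nhb; apply: hv1; apply/hE; apply: (Mmax _ sL).
  - by move=> y My; exact/joinl/My/powers_subgp.
  - move=> [k [_ [Mk [i [j ->]] bE]]]; apply: nhb; exists i, j.
    by rewrite bE gmulfM homF !homX; move/hE: Mk => ->; rewrite mul1g.
  - by apply: joinr => //; exact: powers_id.
have [z gz] := monolithic_cyclic abD pp eD mono hb1.
have [s sE] : exists s : {multiplicative X -> D}, s =1 h \o f by exists (h \o f).
exists D, s, z, p, a; split; first split=> //.
  move=> w; have [u <-] := sh w; have [v <-] := sf u; exists v; exact: sE.
move=> [y yY]; rewrite !sE /= => e; apply: Mb; apply/hE.
by rewrite /b -e; move/fE: yY => ->; exact: hom1.
Qed.

(** By Lagrange, the order of an element of a finite [p]-group has no prime factor
    other than [p].  So isolation with respect to the class of finite [p]-groups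
    implies isolation with respect to [C]. *)
Lemma class_primes_finite_primary (C : groupType -> Prop) q :
  class_primes (finite_primary_class C) q -> class_primes C q.
Proof.
move=> [pq [G [p Cp [T pT isoTG]] [x [n [on qn]]]]]; have [pp _] := Cp.
have [f [f' _ fK]] := isoTG.
have xT : x ^+ #|[set: T]| = 1.
  by rewrite -(fK x) -homX expg_cardG ?inE // hom1.
have /(p_natP)[m Tm] : p.-nat #|[set: T]| by [].
have : (q %| p ^ m)%N.
  by apply: dvdn_trans qn _; rewrite -Tm; exact: has_order_dvdn on xT.
by rewrite Euclid_dvdX // dvdn_prime2 // => /andP[/eqP -> _].
Qed.

Theorem theorem2p1 (C : groupType -> Prop) (X : groupType) :
  root_class C -> periodic_class C -> abelian_group X ->
  (Sep C X -> weakly_bounded C X) /\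
  (weakly_bounded C X -> Sep C X /\ Sep (finite_primary_class C) X).
Proof.
move=> rC pC abX; split; first exact: Sep_weakly_bounded.
move=> wbX; split=> Y cY isoY x xY.
  have [D [s [z [p [m [[Cp ss gz zm] nsx]]]]]] :=
    cyclic_primary_separation rC pC abX wbX cY isoY xY.
  exists D; last by exists s.
  exact: root_class_cyclic Cp gz zm.
have isoY' : isolated (prime_compl (class_primes C)) Y.
  move=> u q [pq nCq]; apply: isoY; split=> //.
  by move=> /class_primes_finite_primary.
have [D [s [z [p [m [[Cp ss gz zm] nsx]]]]]] :=
  cyclic_primary_separation rC pC abX wbX cY isoY' xY.
exists D; last by exists s.
by exists p => //; apply: finite_pgroup_cyclic gz zm; case: Cp.
Qed.
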